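(* Let $T,R>0$, $\alpha>1$, $\lambda,\mu>0$, and for positive integers $N$ let $$G(N):=R^{\frac1\alpha}\left(N\cdot F\left(\frac TN\right)\right)^{\frac{\alpha-1}\alpha},$$ with $F$ as defined in the context. Then $G(N)$ is monotonically increasing with respect to $N$, and $$\lim_{N\to\infty}G(N)=R^{\frac1\alpha}T^{\frac{\alpha-1}\alpha}.$$
   Context: For $T>0$ and $t\in[0,T)$, $$f_T(t):=\left(\frac{\mu+\lambda(\alpha-1)}{(\alpha-1)\left[\bigl(1+\lambda(T-t)\bigr)^{\frac{\mu}{\lambda(\alpha-1)}+1}-1\right]}\right)^{\alpha-1}\bigl(1+\lambda(T-t)\bigr)^{\frac{\mu}{\lambda}}\exp\left(-\alpha\left(\frac{\mu}{\alpha-1}+\lambda\right)\int_0^t\frac{ds}{\bigl(1+\lambda(T-s)\bigr)^{\frac{\mu}{\lambda(\alpha-1)}+1}-1}\right).$$ $x_0$ denotes the unique real solution with $x>1$ of $$(\alpha-1)x^{\frac{\mu}{\lambda}+\alpha-1}-\alpha\left(\frac{\mu}{\lambda(\alpha-1)}+1\right)x^{\alpha-1}+\frac{\mu}{\lambda}=0.$$ For $T>0$: $F(T):=f_T(0)^{-\frac1{\alpha-1}}$ if $T\le\frac{x_0^{\alpha-1}-1}\lambda$, and $F(T):=f_T\left(T-\frac{x_0^{\alpha-1}-1}\lambda\right)^{-\frac1{\alpha-1}}$ if $T>\frac{x_0^{\alpha-1}-1}\lambda$. ($G(N)$ is the maximal total progress attainable with an $N$-stage non-exploitative reward schedule with total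 time $T$ and total reward $R$.) *)

(* Defs.v *)
From Stdlib Require Import Reals Lra.
From Coquelicot Require Import Coquelicot.

Open Scope R_scope.

(* Real powers are [Rpower] throughout: for 1 < alpha, 0 < lambda and 0 < mu,
   every base met below (x > 1, 1 + lambda (T - t) > 1, f_T(t) > 0, N F(T/N) > 0)
   is positive, which is where [Rpower] is the usual power. *)

Definition x0_spec (alpha lambda mu x : R) : Prop :=
  1 < x /\
  (alpha - 1) * Rpower x (mu / lambda + alpha - 1)
    - alpha * (mu / (lambda * (alpha - 1)) + 1) * Rpower x (alpha - 1)
    + mu / lambda = 0.

Lemma x0_exists_unique (alpha lambda mu : R) :
  1 < alpha -> 0 < lambda -> 0 < mu ->
  exists! x, x0_spec alpha lambda mu x.
Proof.
intros Ha Hl Hm.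
assert (Hp : 0 < mu / lambda) by (apply Rdiv_lt_0_compat; lra).
set (p := mu / lambda) in *.
assert (Hpa : mu / (lambda * (alpha - 1)) = p / (alpha - 1))
  by (unfold p; field; lra).
set (a := alpha - 1) in *.
assert (Ha0 : 0 < a) by (unfold a; lra).
set (C := alpha * (p / a + 1)).
set (psi := fun u => a * exp (p * u) + p * exp (- a * u)).
assert (Hspec : forall u, 0 < u ->
          (x0_spec alpha lambda mu (exp u) <-> psi u = C)).
{ intros u Hu.
  unfold x0_spec. fold p a. rewrite Hpa. fold C. unfold Rpower.
  rewrite ln_exp.
  replace ((p + alpha - 1) * u) with (p * u + a * u) by (unfold a; ring).
  rewrite exp_plus.
  assert (He : exp (- a * u) = / exp (a * u))
    by (rewrite <- exp_Ropp; f_equal; ring).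
  unfold psi. rewrite He.
  assert (H1 : 1 < exp u) by (rewrite <- exp_0; apply exp_increasing; lra).
  assert (H2 := exp_pos (a * u)).
  set (E := exp (a * u)) in *. set (P := exp (p * u)).
  split.
  - intros [_ H].
    apply (Rmult_eq_reg_r E); [|lra].
    replace ((a * P + p * / E) * E) with (a * (P * E) + p) by (field; lra).
    lra.
  - intros H. split; [exact H1|].
    rewrite <- H. field. lra. }
assert (Hinc : forall u v, 0 <= u -> u < v -> psi u < psi v).
{ intros u v Hu Huv.
  destruct (MVT_cor2 psi
              (fun u => a * (p * exp (p * u)) + p * (- a * exp (- a * u)))
              u v Huv) as [c [Hc Hcuv]].
  { intros c _. apply is_derive_Reals. unfold psi.
    auto_derive; [trivial|ring]. }
  assert (exp (- a * c) < exp (p * c))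
    by (apply exp_increasing; nra).
  assert (0 < (a * (p * exp (p * c)) + p * (- a * exp (- a * c))) * (v - u));
    [|lra].
  apply Rmult_lt_0_compat; [|lra].
  replace (a * (p * exp (p * c)) + p * (- a * exp (- a * c)))
    with (a * p * (exp (p * c) - exp (- a * c))) by ring.
  apply Rmult_lt_0_compat; nra. }
assert (H0 : psi 0 < C).
{ unfold psi, C. rewrite !Rmult_0_r, exp_0.
  assert (0 < p / a) by (apply Rdiv_lt_0_compat; lra).
  replace alpha with (a + 1) by (unfold a; ring).
  replace ((a + 1) * (p / a + 1)) with (p + a + p / a + 1) by (field; lra).
  lra. }
assert (HM : exists M, 0 < M /\ C < psi M).
{ assert (HC : 0 < C).
  { unfold psi in H0. rewrite !Rmult_0_r, exp_0 in H0. lra. }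
  exists (C / (a * p)).
  assert (0 < a * p) by nra.
  assert (HM0 : 0 < C / (a * p)) by (apply Rdiv_lt_0_compat; lra).
  split; [exact HM0|].
  unfold psi.
  assert (1 + p * (C / (a * p)) < exp (p * (C / (a * p))))
    by (apply exp_ineq1; nra).
  assert (a * (p * (C / (a * p))) = C) by (field; lra).
  assert (0 < exp (- a * (C / (a * p)))) by apply exp_pos.
  nra. }
destruct HM as [M [HM0 HM]].
destruct (IVT (fun u => psi u - C) 0 M) as [u [Hu Hu0]]; try lra.
{ intros c. apply continuity_pt_filterlim.
  apply (ex_derive_continuous (fun u => psi u - C)).
  unfold psi. auto_derive. trivial. }
assert (Hupos : 0 < u).
{ destruct (Req_dec u 0) as [E|E]; [subst u; lra|lra]. }
exists (exp u). split.
- apply Hspec; lra.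
- intros y Hy.
  assert (Hy1 : 1 < y) by apply Hy.
  assert (Hly : 0 < ln y) by (rewrite <- ln_1; apply ln_increasing; lra).
  rewrite <- (exp_ln y) in Hy by lra.
  apply Hspec in Hy; [|exact Hly].
  rewrite <- (exp_ln y) by lra. f_equal.
  destruct (Rtotal_order u (ln y)) as [H|[H|H]]; [|exact H|].
  + assert (psi u < psi (ln y)) by (apply Hinc; lra). lra.
  + assert (psi (ln y) < psi u) by (apply Hinc; lra). lra.
Qed.

Definition x0 (alpha lambda mu : R) : R := iota (x0_spec alpha lambda mu).

Lemma x0P (alpha lambda mu : R) :
  1 < alpha -> 0 < lambda -> 0 < mu ->
  x0_spec alpha lambda mu (x0 alpha lambda mu).
Proof.
intros Ha Hl Hm.
apply (iota_correct (x0_spec alpha lambda mu)).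
now apply x0_exists_unique.
Qed.

Definition f (alpha lambda mu T t : R) : R :=
  Rpower
    ((mu + lambda * (alpha - 1)) /
     ((alpha - 1) *
      (Rpower (1 + lambda * (T - t)) (mu / (lambda * (alpha - 1)) + 1) - 1)))
    (alpha - 1)
  * Rpower (1 + lambda * (T - t)) (mu / lambda)
  * exp (- alpha * (mu / (alpha - 1) + lambda) *
         RInt (fun s =>
           1 / (Rpower (1 + lambda * (T - s))
                  (mu / (lambda * (alpha - 1)) + 1) - 1)) 0 t).

Definition threshold (alpha lambda mu : R) : R :=
  (Rpower (x0 alpha lambda mu) (alpha - 1) - 1) / lambda.

Definition F (alpha lambda mu T : R) : R :=
  if Rle_dec T (threshold alpha lambda mu)
  then Rpower (f alpha lambda mu T 0) (- (1 / (alpha - 1)))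
  else Rpower (f alpha lambda mu T (T - threshold alpha lambda mu))
              (- (1 / (alpha - 1))).

(* [Rew] is the total reward; only N >= 1 is meaningful. *)
Definition G (alpha lambda mu T Rew : R) (N : nat) : R :=
  Rpower Rew (1 / alpha)
  * Rpower (INR N * F alpha lambda mu (T / INR N)) ((alpha - 1) / alpha).

(* Main.v *)
(** Since [N * F (T / N) = T * (F u / u)] with [u = T / N], monotonicity of [G] is
    strict decrease of [F u / u], and the limit is [F u / u -> 1] as [u -> 0].
    Put [q = mu / (lambda (alpha - 1)) + 1] and [y = 1 + lambda u].  Below the
    threshold, [F u = (y - y^(1-q)) / (lambda q)], and [F u / u] decreases by
    Bernoulli's inequality [y^q > 1 + q (y - 1)].  Above the threshold, [F] solves
    [F' / F = (alpha lambda q / (alpha - 1)) / (y^q - 1)]; the equation of [x0] is what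
    makes the right-hand side smaller than [1 / u]. *)

Require Import Defs.
From Stdlib Require Import Reals Lra Lia.
From Coquelicot Require Import Coquelicot.

Open Scope R_scope.

(** * Real powers and Bernoulli's inequality *)

Lemma Rpower_pos (x c : R) : 0 < Rpower x c.
Proof. apply exp_pos. Qed.

Lemma Rpower_base_1 (c : R) : Rpower 1 c = 1.
Proof. unfold Rpower. now rewrite ln_1, Rmult_0_r, exp_0. Qed.

Lemma Rpower_gt_1 (x c : R) : 1 < x -> 0 < c -> 1 < Rpower x c.
Proof.
intros Hx Hc. rewrite <- (Rpower_O x) by lra. now apply Rpower_lt.
Qed.

(** Mean value theorem for [z^q] on [[1, y]]: the slope [q c^(q-1)] exceeds [q] because [c > 1]. *)
Lemma bernoulli_Rpower (y q : R) : 1 < y -> 1 < q -> 1 + q * (y - 1) < Rpower y q.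
Proof.
intros Hy Hq.
destruct (MVT_cor2 (fun z => Rpower z q) (fun z => q * Rpower z (q - 1)) 1 y Hy)
  as [c [Hc Hcy]].
{ intros c Hc. apply derivable_pt_lim_power. lra. }
rewrite Rpower_base_1 in Hc.
assert (1 < Rpower c (q - 1)) by (apply Rpower_gt_1; lra).
assert (0 < q * (y - 1)) by (apply Rmult_lt_0_compat; lra).
nra.
Qed.

(** * The closed form below the threshold *)

(** The first two factors of [f], raised to the power [-1/(alpha-1)], as a function of the remaining
    time [u]. It is smooth at [u = 0]. *)
Definition F_low (q lambda u : R) : R :=
  (1 + lambda * u - Rpower (1 + lambda * u) (1 - q)) / (lambda * q).

Lemma is_derive_F_low (q lambda u : R) :
  0 < lambda -> 1 < q -> 0 < 1 + lambda * u ->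
  is_derive (F_low q lambda) u ((1 + (q - 1) * Rpower (1 + lambda * u) (- q)) / q).
Proof.
intros Hl Hq Hu. unfold F_low, Rpower.
auto_derive; [exact Hu|].
replace ((1 - q) * ln (1 + lambda * u)) with
  (- q * ln (1 + lambda * u) + ln (1 + lambda * u)) by ring.
rewrite exp_plus, exp_ln by exact Hu. field. lra.
Qed.

(** With [y = 1 + lambda c], the numerator of the derivative of the quotient at [c] is
    [-(y^q - 1 - q (y - 1)) / (lambda q y^q)], negative by Bernoulli. *)
Lemma F_low_ratio_decr (q lambda u v : R) :
  0 < lambda -> 1 < q -> 0 < u -> u < v ->
  F_low q lambda v / v < F_low q lambda u / u.
Proof.
intros Hl Hq Hu Huv.
destruct (MVT_cor2 (fun w => F_low q lambda w / w)
  (fun w => ((1 + (q - 1) * Rpower (1 + lambda * w) (- q)) / q * w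
             - F_low q lambda w) / w ^ 2) u v Huv) as [c [Hc Hcuv]].
{ intros c Hc. apply is_derive_Reals.
  replace (_ / c ^ 2) with
    (((1 + (q - 1) * Rpower (1 + lambda * c) (- q)) / q * c
      - F_low q lambda c * 1) / c ^ 2) by (f_equal; ring).
  apply is_derive_div.
  - apply is_derive_F_low; nra.
  - apply (@is_derive_id R_AbsRing).
  - lra. }
assert (Hy : 1 < 1 + lambda * c) by nra.
assert (HB := bernoulli_Rpower _ q Hy Hq).
assert (Hneg : (1 + (q - 1) * Rpower (1 + lambda * c) (- q)) / q * c
                 - F_low q lambda c < 0).
{ unfold F_low.
  replace (1 - q) with (1 + - q) by ring.
  rewrite Rpower_plus, Rpower_1, Rpower_Ropp by lra.
  set (P := Rpower (1 + lambda * c) q) in *.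
  assert (HP : 0 < P) by apply Rpower_pos.
  replace (_ - _) with (- (P - (1 + q * (1 + lambda * c - 1))) / (P * (lambda * q)))
    by (field; lra).
  apply Ropp_lt_cancel. rewrite Ropp_0.
  unfold Rdiv. rewrite <- Ropp_mult_distr_l, Ropp_involutive.
  apply Rdiv_lt_0_compat; [lra|].
  repeat apply Rmult_lt_0_compat; lra. }
assert (0 < c ^ 2) by (apply pow_lt; lra).
assert (0 < - ((1 + (q - 1) * Rpower (1 + lambda * c) (- q)) / q * c
                 - F_low q lambda c) / c ^ 2 * (v - u)).
{ apply Rmult_lt_0_compat; [apply Rdiv_lt_0_compat|]; lra. }
unfold Rdiv in *. lra.
Qed.

(** Since [F_low] vanishes at 0, this is its difference quotient there, and the derivative at 0 is
    [(1 + (q - 1)) / q = 1]. *)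
Lemma is_lim_seq_F_low_ratio (q lambda : R) (w : nat -> R) :
  0 < lambda -> 1 < q -> (forall n, w n <> 0) -> is_lim_seq w 0 ->
  is_lim_seq (fun n => F_low q lambda (w n) / w n) 1.
Proof.
intros Hl Hq Hw Hlim.
assert (HD : derivable_pt_lim (F_low q lambda) 0 1).
{ apply is_derive_Reals.
  assert (E := is_derive_F_low q lambda 0 Hl Hq).
  rewrite Rmult_0_r, Rplus_0_r, Rpower_base_1 in E.
  replace 1 with ((1 + (q - 1) * 1) / q) at 1 by (field; lra).
  apply E; lra. }
assert (H0 : F_low q lambda 0 = 0).
{ unfold F_low. rewrite Rmult_0_r, Rplus_0_r, Rpower_base_1. field; lra. }
apply is_lim_seq_spec. intros eps.
destruct (HD eps (cond_pos eps)) as [d Hd].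
apply is_lim_seq_spec in Hlim. destruct (Hlim d) as [n0 Hn0].
exists n0. intros n Hn. specialize (Hn0 n Hn). rewrite Rminus_0_r in Hn0.
specialize (Hd (w n) (Hw n) Hn0).
now rewrite Rplus_0_l, H0, Rminus_0_r in Hd.
Qed.

(** * The integrand of the exponential factor *)

(** The integrand in [f] in terms of the remaining time; it is singular at [u = 0], so integration
    stays on positive reals. *)
Definition kernel (q lambda u : R) : R := 1 / (Rpower (1 + lambda * u) q - 1).

Lemma continuous_kernel (q lambda u : R) :
  0 < lambda -> 1 < q -> 0 < u -> continuous (kernel q lambda) u.
Proof.
intros Hl Hq Hu.
assert (1 < 1 + lambda * u) by nra.
assert (H1 := Rpower_gt_1 (1 + lambda * u) q).
apply (ex_derive_continuous (kernel q lambda)).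
unfold kernel, Rpower in *. auto_derive. repeat split; lra.
Qed.

Lemma ex_RInt_kernel (q lambda u v : R) :
  0 < lambda -> 1 < q -> 0 < u -> 0 < v -> ex_RInt (kernel q lambda) u v.
Proof.
intros Hl Hq Hu Hv. apply (ex_RInt_continuous (V := R_CompleteNormedModule)). intros z [Hz _].
apply continuous_kernel; try assumption.
apply Rlt_le_trans with (2 := Hz). now apply Rmin_glb_lt.
Qed.

Lemma is_RInt_inv (u v : R) : 0 < u -> u <= v -> is_RInt Rinv u v (ln v - ln u).
Proof.
intros Hu Huv.
apply (is_RInt_derive ln Rinv); intros x; rewrite Rmin_left by assumption; intros Hx.
- apply is_derive_Reals, derivable_pt_lim_ln. lra.
- apply continuous_Rinv. lra.
Qed.

(** * The threshold and the growth rate above it *)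

Section MaximalProgress.

Context (alpha lambda mu : R) (Ha : 1 < alpha) (Hl : 0 < lambda) (Hm : 0 < mu).

Let q := mu / (lambda * (alpha - 1)) + 1.
Let theta := threshold alpha lambda mu.
(** The coefficient of the integral in [f] is [-alpha lambda q]; the outer power multiplies it by
    [-1/(alpha-1)]. *)
Let K := alpha / (alpha - 1) * (lambda * q).

Lemma exponent_gt_1 : 1 < q.
Proof.
unfold q. assert (0 < mu / (lambda * (alpha - 1))); [|lra].
apply Rdiv_lt_0_compat; [lra|]. apply Rmult_lt_0_compat; lra.
Qed.

Lemma threshold_pos : 0 < theta.
Proof.
destruct (x0P alpha lambda mu Ha Hl Hm) as [Hx _].
apply Rdiv_lt_0_compat; [|exact Hl].
assert (1 < Rpower (x0 alpha lambda mu) (alpha - 1)) by (apply Rpower_gt_1; lra).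
lra.
Qed.

(** The equation of [x0] in the variable [x0^(alpha-1) = 1 + lambda theta], using
    [(alpha-1) q = mu/lambda + alpha - 1]. *)
Lemma threshold_eq :
  (alpha - 1) * Rpower (1 + lambda * theta) q
    = alpha * q * (1 + lambda * theta) - (alpha - 1) * (q - 1).
Proof.
destruct (x0P alpha lambda mu Ha Hl Hm) as [Hx E].
replace (1 + lambda * theta) with (Rpower (x0 alpha lambda mu) (alpha - 1))
  by (unfold theta, threshold; field; lra).
rewrite Rpower_mult.
replace ((alpha - 1) * q) with (mu / lambda + alpha - 1) by (unfold q; field; lra).
replace ((alpha - 1) * (q - 1)) with (mu / lambda) by (unfold q; field; lra).
fold q in E. lra.
Qed.

(** Clearing denominators gives [Key]. At [y = z] the threshold equation makes its two sides differ
    by exactly [q]; convexity of [y^q] keeps the gap from shrinking for [y > z]. *)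
Lemma kernel_lt_inv (u : R) : theta <= u -> K * kernel q lambda u < / u.
Proof.
intros Hu.
assert (Hq := exponent_gt_1). assert (Ht := threshold_pos).
assert (E := threshold_eq).
set (a := alpha - 1) in *. assert (Ha0 : 0 < a) by (unfold a; lra).
set (z := 1 + lambda * theta) in *.
assert (Hz : 1 < z) by (unfold z; nra).
set (y := 1 + lambda * u).
assert (Hy : z <= y) by (unfold y, z; nra).
assert (Key : alpha * q * (y - 1) < a * (Rpower y q - 1)).
{ set (P := Rpower z q) in *.
  (* Tangent bound for [y^q] at [z]: Bernoulli for [y / z], scaled by [z^q]; equality when
     [y = z]. *)
  assert (HB : P * (1 + q * (y / z - 1)) <= Rpower y q).
  { replace (Rpower y q) with (P * Rpower (y / z) q).
    2:{ unfold P. rewrite Rpower_mult_distr.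
        - f_equal. field; lra.
        - lra.
        - apply Rdiv_lt_0_compat; lra. }
    apply Rmult_le_compat_l; [apply Rlt_le, Rpower_pos|].
    destruct Hy as [Hy|Hy].
    - apply Rlt_le, bernoulli_Rpower; [|exact Hq].
      apply (Rmult_lt_reg_r z); [lra|]. unfold Rdiv.
      rewrite Rmult_assoc, Rinv_l; lra.
    - rewrite Hy. unfold Rdiv. rewrite Rinv_r by lra. rewrite Rpower_base_1. lra. }
  replace (P * (1 + q * (y / z - 1))) with (P + q * (P / z) * (y - z)) in HB
    by (field; lra).
  (* The slope of the tangent at [z] already dominates that of the right-hand side. *)
  assert (HS : alpha <= a * (P / z)).
  { replace (a * (P / z)) with (a * P / z) by (field; lra).
    apply (Rmult_le_reg_r z); [lra|]. unfold Rdiv. rewrite Rmult_assoc, Rinv_l by lra.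
    rewrite E.
    assert (0 <= (q - 1) * (alpha * z - a)).
    { apply Rmult_le_pos; [lra|]. unfold a. nra. }
    lra. }
  assert (0 <= (a * (P / z) - alpha) * (q * (y - z))).
  { apply Rmult_le_pos; [lra|]. apply Rmult_le_pos; lra. }
  assert (a * (P + q * (P / z) * (y - z)) <= a * Rpower y q)
    by (apply Rmult_le_compat_l; lra).
  (* Inserting the threshold equation for [a * P] leaves the slack [alpha q - a q = q > 0]. *)
  unfold a in *. nra. }
unfold K, kernel. fold y a.
assert (0 < u) by lra.
assert (Huy : y - 1 = lambda * u) by (unfold y; ring).
assert (0 < lambda * u) by nra.
assert (0 < Rpower y q - 1).
{ assert (1 < Rpower y q) by (apply Rpower_gt_1; lra). lra. }
apply (Rmult_lt_reg_r (u * (a * (Rpower y q - 1)))).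
{ repeat apply Rmult_lt_0_compat; lra. }
replace (alpha / a * (lambda * q) * (1 / (Rpower y q - 1)) * (u * (a * (Rpower y q - 1))))
  with (alpha * q * (lambda * u)) by (field; lra).
replace (/ u * (u * (a * (Rpower y q - 1)))) with (a * (Rpower y q - 1)) by (field; lra).
rewrite <- Huy. exact Key.
Qed.

(** * Explicit formulas for [F] on both sides of the threshold *)

Lemma RInt_kernel_reflect (u t : R) : 0 < u -> 0 < u - t ->
  RInt (fun s => kernel q lambda (u - s)) 0 t = RInt (kernel q lambda) (u - t) u.
Proof.
intros Hu Hut.
assert (Hq := exponent_gt_1).
(* The bounds enter through equations because the substitution produces them as [-1 * 0 + u] and
   [-1 * t + u]. *)
assert (Hex : forall a b, a = u -> b = u - t -> ex_RInt (kernel q lambda) a b).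
{ intros a b -> ->. now apply ex_RInt_kernel. }
assert (E := RInt_comp_lin (kernel q lambda) (-1) u 0 t
  ltac:(apply Hex; ring)).
replace (-1 * 0 + u) with u in E by ring.
replace (-1 * t + u) with (u - t) in E by ring.
rewrite <- (opp_RInt_swap (kernel q lambda)) by (apply Hex; reflexivity).
rewrite <- E, <- RInt_opp.
- apply RInt_ext. intros s _. unfold opp, scal; simpl. unfold mult; simpl.
  replace (-1 * s + u) with (u - s) by ring. ring.
- apply (ex_RInt_comp_lin (kernel q lambda) (-1) u). apply Hex; ring.
Qed.

(** The power distributes over the three factors of [f]: with [Y = 1 + lambda (u - t)] they become
    [(Y^q - 1) / (lambda q)], [Y^(1-q)] and the exponential. *)
Lemma f_root (u t : R) : 0 < u -> 0 < u - t ->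
  Rpower (Defs.f alpha lambda mu u t) (- (1 / (alpha - 1)))
    = F_low q lambda (u - t) * exp (K * RInt (kernel q lambda) (u - t) u).
Proof.
intros Hu Hut.
assert (Hq := exponent_gt_1).
rewrite <- RInt_kernel_reflect by assumption.
unfold Defs.f, F_low, kernel. fold q.
set (I := RInt _ 0 t : R).
set (Y := 1 + lambda * (u - t)).
assert (HY : 1 < Y) by (unfold Y; nra).
assert (HP : 1 < Rpower Y q) by (apply Rpower_gt_1; lra).
replace ((mu + lambda * (alpha - 1)) / ((alpha - 1) * (Rpower Y q - 1)))
  with (lambda * q / (Rpower Y q - 1))
  by (set (P := Rpower Y q) in *; unfold q; field; repeat split; lra).
assert (Hb : 0 < lambda * q / (Rpower Y q - 1)).
{ apply Rdiv_lt_0_compat; [apply Rmult_lt_0_compat|]; lra. }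
rewrite <- !Rpower_mult_distr;
  try apply Rmult_lt_0_compat; try apply Rpower_pos; try apply exp_pos.
replace (Rpower (exp _) _) with (exp (K * I))
  by (unfold Rpower; rewrite ln_exp; f_equal; unfold K, q; field; lra).
rewrite !Rpower_mult.
replace ((alpha - 1) * - (1 / (alpha - 1))) with (- (1)) by (field; lra).
replace (mu / lambda * - (1 / (alpha - 1))) with (1 + - q) by (unfold q; field; lra).
replace (1 - q) with (1 + - q) by ring.
rewrite Rpower_plus, !Rpower_Ropp, !Rpower_1 by lra.
field. repeat split; lra.
Qed.

Lemma F_below (u : R) : 0 < u -> u <= theta -> F alpha lambda mu u = F_low q lambda u.
Proof.
intros Hu Hut. unfold F. fold theta.
destruct (Rle_dec u theta); [|lra].
rewrite f_root by lra. rewrite Rminus_0_r, RInt_point.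
unfold zero; simpl. rewrite Rmult_0_r, exp_0. ring.
Qed.

(** At [u = theta] the other branch of [F] applies, but the integral is empty and the formulas
    agree; this lets the two regimes be joined at [theta]. *)
Lemma F_above (u : R) : theta <= u ->
  F alpha lambda mu u = F_low q lambda theta * exp (K * RInt (kernel q lambda) theta u).
Proof.
intros Hu. assert (Ht := threshold_pos).
destruct Hu as [Hu| <-].
- unfold F. fold theta.
  destruct (Rle_dec u theta); [lra|].
  rewrite f_root by lra. now replace (u - (u - theta)) with theta by ring.
- rewrite F_below by lra. rewrite RInt_point.
  unfold zero; simpl. rewrite Rmult_0_r, exp_0. ring.
Qed.

Lemma F_pos (u : R) : 0 < u -> 0 < F alpha lambda mu u.
Proof.
intros Hu. unfold F. destruct (Rle_dec _ _); apply Rpower_pos.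
Qed.

(** * Monotonicity and limit of [F u / u] *)

(** From [u] to [v], [F] grows by the exponential of the integral of [K * kernel], which is less
    than the integral of [1/w], so by a factor less than [v / u]. *)
Lemma F_ratio_decr_above (u v : R) : theta <= u -> u < v ->
  F alpha lambda mu v / v < F alpha lambda mu u / u.
Proof.
intros Hu Huv.
assert (Ht := threshold_pos). assert (Hq := exponent_gt_1).
assert (Hcont : forall x, 0 < x -> continuous (fun w => K * kernel q lambda w) x).
{ intros x Hx. apply (continuous_scal_r K (kernel q lambda)).
  now apply continuous_kernel. }
assert (HI : K * RInt (kernel q lambda) u v < ln v - ln u).
{ rewrite <- (is_RInt_unique _ _ _ _ (is_RInt_inv u v ltac:(lra) ltac:(lra))).
  change (K * RInt (kernel q lambda) u v) with (scal K (RInt (kernel q lambda) u v)).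
  rewrite <- (RInt_scal (kernel q lambda)) by (apply ex_RInt_kernel; lra).
  apply RInt_lt; [exact Huv| | |].
  - intros x Hx. apply continuous_Rinv. lra.
  - intros x Hx. apply Hcont. lra.
  - intros x Hx. apply kernel_lt_inv. lra. }
assert (E : F alpha lambda mu v
          = F alpha lambda mu u * exp (K * RInt (kernel q lambda) u v)).
{ rewrite !F_above by lra.
  rewrite Rmult_assoc, <- exp_plus, <- Rmult_plus_distr_l.
  now rewrite <- (RInt_Chasles (kernel q lambda) theta u v)
    by (apply ex_RInt_kernel; lra). }
assert (HF := F_pos u ltac:(lra)).
apply exp_increasing in HI. unfold Rminus in HI.
rewrite exp_plus, exp_Ropp, !exp_ln in HI by lra.
rewrite E. unfold Rdiv. rewrite Rmult_assoc.
apply Rmult_lt_compat_l; [exact HF|].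
apply (Rmult_lt_reg_r v); [lra|].
rewrite Rmult_assoc, Rinv_l, Rmult_1_r by lra. lra.
Qed.

Lemma F_ratio_decr (u v : R) : 0 < u -> u < v ->
  F alpha lambda mu v / v < F alpha lambda mu u / u.
Proof.
intros Hu Huv.
assert (Ht := threshold_pos). assert (Hq := exponent_gt_1).
assert (Hlow : forall w, u < w -> w <= theta ->
          F alpha lambda mu w / w < F alpha lambda mu u / u).
{ intros w Huw Hw. rewrite !F_below by lra. now apply F_low_ratio_decr. }
destruct (Rle_lt_dec theta u) as [H|H]; [now apply F_ratio_decr_above|].
destruct (Rle_lt_dec v theta) as [H'|H']; [now apply Hlow|].
(* For [u < theta < v] the two regimes are chained through [theta]. *)
apply Rlt_trans with (F alpha lambda mu theta / theta).
- apply F_ratio_decr_above; lra.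
- apply Hlow; lra.
Qed.

(** Eventually [w n < theta], where [F] coincides with [F_low]. *)
Lemma is_lim_seq_F_ratio (w : nat -> R) :
  (forall n, 0 < w n) -> is_lim_seq w 0 ->
  is_lim_seq (fun n => F alpha lambda mu (w n) / w n) 1.
Proof.
intros Hw Hlim.
apply is_lim_seq_ext_loc with (fun n => F_low q lambda (w n) / w n).
- apply is_lim_seq_spec in Hlim.
  destruct (Hlim (mkposreal theta threshold_pos)) as [n0 Hn0].
  exists n0. intros n Hn. specialize (Hn0 n Hn). simpl in Hn0.
  apply Rabs_def2 in Hn0. rewrite F_below; [reflexivity|apply Hw|lra].
- apply is_lim_seq_F_low_ratio; [exact Hl|apply exponent_gt_1| |exact Hlim].
  intros n. apply Rgt_not_eq, Hw.
Qed.

End MaximalProgress.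

(** * Transfer to [G] *)

Lemma continuous_Rpower_base (x c : R) : 0 < x -> continuity_pt (fun z => Rpower z c) x.
Proof.
intros Hx. apply derivable_continuous_pt.
exists (c * Rpower x (c - 1)). now apply derivable_pt_lim_power.
Qed.

Theorem theorem12 (alpha lambda mu T Rew : R)
    (hT : 0 < T) (hRew : 0 < Rew)
    (halpha : 1 < alpha) (hlambda : 0 < lambda) (hmu : 0 < mu) :
  (forall N M : nat, (0 < N)%nat -> (N < M)%nat ->
     G alpha lambda mu T Rew N < G alpha lambda mu T Rew M)
  /\ is_lim_seq (G alpha lambda mu T Rew)
       (Finite (Rpower Rew (1 / alpha) * Rpower T ((alpha - 1) / alpha))).
Proof.
assert (Hscale : forall N, (0 < N)%nat ->
          0 < T / INR N /\
          INR N * F alpha lambda mu (T / INR N)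
            = T * (F alpha lambda mu (T / INR N) / (T / INR N))).
{ intros N HN. apply lt_0_INR in HN. split.
  - now apply Rdiv_lt_0_compat.
  - field. lra. }
split.
- intros N M HN HNM.
  destruct (Hscale N HN) as [HuN EN].
  destruct (Hscale M) as [HuM EM]; [lia|].
  unfold G. apply Rmult_lt_compat_l; [apply Rpower_pos|].
  apply Rlt_Rpower_l; [apply Rdiv_lt_0_compat; lra|].
  split.
  + apply Rmult_lt_0_compat; [now apply lt_0_INR|now apply F_pos].
  + rewrite EN, EM. apply Rmult_lt_compat_l; [exact hT|].
    apply F_ratio_decr; try assumption.
    apply lt_0_INR in HN. apply lt_INR in HNM.
    apply Rmult_lt_compat_l; [exact hT|].
    apply Rinv_lt_contravar; [apply Rmult_lt_0_compat|]; lra.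
(* The shift to [S n] discards the index 0, where [T / INR N] is meaningless. *)
- apply is_lim_seq_incr_1.
  apply (is_lim_seq_scal_l _ (Rpower Rew (1 / alpha)) (Rpower T ((alpha - 1) / alpha))).
  apply (is_lim_seq_continuous (fun z => Rpower z ((alpha - 1) / alpha)));
    [now apply continuous_Rpower_base|].
  apply is_lim_seq_ext with
    (fun n => T * (F alpha lambda mu (T / INR (S n)) / (T / INR (S n)))).
  { intros n. symmetry. apply Hscale. lia. }
  replace (Finite T) with (Rbar_mult T 1) by (simpl; f_equal; ring).
  apply is_lim_seq_scal_l.
  apply (is_lim_seq_F_ratio alpha lambda mu halpha hlambda hmu (fun n => T / INR (S n))).
  + intros n. apply Hscale. lia.
  + apply (is_lim_seq_incr_1 (fun n => T / INR n)).
    (* The limit 0 is put in the shape [T * (1 / infinity)] produced by the limit rules. *)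
    replace (Finite 0) with (Rbar_mult T (Rbar_inv p_infty))
      by (simpl; f_equal; ring).
    apply is_lim_seq_scal_l.
    apply is_lim_seq_inv; [apply is_lim_seq_INR|discriminate].
Qed.
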